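(* Let $\Lambda$ be a left-filtering partially ordered index set, let $\mathcal{B}_0\subset(\mathbb{R}_+^* )^\Lambda$ be a family of nets, and let $\mathcal{B}$, $A_{\mathcal{B}}$, $I_{\mathcal{B}}$ be the associated set of rational expressions, overgenerated ring and canonical ideal. Let $d\ge 1$ and let $\mathcal{M}(\mathbb{R}^d)$ and $\mathcal{N}(\mathbb{R}^d)$ be the associated sets of moderate and negligible nets of smooth functions on $\mathbb{R}^d$. Assume that there exists $(a_\lambda)_\lambda\in\mathcal{B}$ with $\lim_\Lambda a_\lambda=0$. Then a net $(u_\lambda)_\lambda\in\mathcal{M}(\mathbb{R}^d)$ belongs to $\mathcal{N}(\mathbb{R}^d)$ if and only if for every compact set $K\subset\mathbb{R}^d$ one has $$\Big(\sup_{x\in K}|u_\lambda(x)|\Big)_\lambda\in|I_{\mathcal{B}}|.$$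
   Context: Let $\mathbb{K}=\mathbb{R}$ or $\mathbb{C}$, and $\mathbb{R}_+^*=(0,\infty)$. $\Lambda$ is a nonempty set with a partial order $\preceq$ that is left filtering: for all $\lambda,\mu\in\Lambda$ there is $\nu\in\Lambda$ with $\nu\preceq\lambda$ and $\nu\preceq\mu$. For a real net, $\lim_\Lambda a_\lambda=0$ means: for all $\varepsilon>0$ there is $\lambda_0\in\Lambda$ such that $|a_\lambda|\le\varepsilon$ for all $\lambda\preceq\lambda_0$. For $(a_\lambda)_\lambda,(b_\lambda)_\lambda\in\mathbb{R}^\Lambda$, write $a_\lambda\ll b_\lambda$ if there is $\lambda_0\in\Lambda$ such that $a_\lambda\le b_\lambda$ for all $\lambda\preceq\lambda_0$. Given a family $\mathcal{B}_0\subset(\mathbb{R}_+^* )^\Lambda$, $\mathcal{B}\subset(\mathbb{R}_+^* )^\Lambda$ is the set of all nets obtained as rational functions, with coefficients in $\mathbb{R}_+^*$, of (finitely many) elements of $\mathcal{B}_0$ as variables; that is, all quotients $P/Q$, evaluated pointwise in $\lambda$ at finitely many elements of $\mathcal{B}_0$, where $P$ and $Q$ are nonzero polynomials all of whose occurring monomials have strictly positive real coefficients. In particular $\mathcal{B}$ is stable under sums, products and inverses. Define $$A_{\mathcal{B}}=\{(a_\lambda)_\lambda\in\mathbb{K}^\Lambda\mid\exists (b_\lambda)_\lambda\in\mathcal{B}:\ |a_\lambda|\ll b_\lambda\},$$ $$I_{\mathcal{B}}=\{(a_\lambda)_\lambda\in\mathbb{K}^\Lambda\mid\forall (b_\lambda)_\lambda\in\mathcal{B}:\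 |a_\lambda|\ll b_\lambda\}.$$ For $B=A_{\mathcal{B}}$ or $I_{\mathcal{B}}$, put $|B|=\{(|r_\lambda|)_\lambda : (r_\lambda)_\lambda\in B\}$, which equals the set of nets in $B$ with all entries $\geq 0$. For $K\subset\mathbb{R}^d$ compact, $l\in\mathbb{N}=\{0,1,2,\dots\}$ and a smooth $\mathbb{K}$-valued function $u\in\mathrm{C}^\infty(\mathbb{R}^d)$, let $$P_{K,l}(u)=\sup_{|\alpha|\le l}\ \sup_{x\in K}|\partial^\alpha u(x)|,$$ where $\alpha$ ranges over multi-indices in $\mathbb{N}^d$. Define $$\mathcal{M}(\mathbb{R}^d)=\{(u_\lambda)_\lambda\in \mathrm{C}^\infty(\mathbb{R}^d)^\Lambda:\ \forall K\subset\mathbb{R}^d\text{ compact},\ \forall l\in\mathbb{N},\ (P_{K,l}(u_\lambda))_\lambda\in|A_{\mathcal{B}}|\},$$ $$\mathcal{N}(\mathbb{R}^d)=\{(u_\lambda)_\lambda\in \mathrm{C}^\infty(\mathbb{R}^d)^\Lambda:\ \forall K\subset\mathbb{R}^d\text{ compact},\ \forall l\in\mathbb{N},\ (P_{K,l}(u_\lambda))_\lambda\in|I_{\mathcal{B}}|\}.$$ *)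

(* Defs.v *)
From HB Require Import structures.
From mathcomp Require Import all_boot all_order all_algebra.
From mathcomp Require Import all_classical all_reals all_analysis.
From mathcomp Require Import complex.
From mathcomp Require Import -(notations) mpoly.

Set Implicit Arguments.
Unset Strict Implicit.
Unset Printing Implicit Defensive.

Import Order.TTheory GRing.Theory Num.Theory.
Import numFieldNormedType.Exports.

Local Open Scope classical_set_scope.
Local Open Scope ring_scope.

(* [Rcomplex R] is the field R[i] seen as a module over R, with the R-valued
   modulus as norm; here it receives the topology of that norm, so that
   derivatives along real directions of complex-valued functions make sense. *)
Section Rcomplex_normedModType.
Variable R : realType.

HB.instance Definition _ :=
  PseudoMetric.copy (Rcomplex R) (pseudoMetric_normed (Rcomplex R)).
HB.instance Definition _ := isPointed.Build (Rcomplex R) 0.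
HB.instance Definition _ :=
  NormedZmod_PseudoMetric_eq.Build R (Rcomplex R) erefl.

Lemma Rcomplex_normrZ (r : R) (z : Rcomplex R) : `|r *: z| = `|r| * `|z|.
Proof.
case: z => a b; rewrite /Num.norm/= /ComplexField.Normc.normc/=.
by rewrite !exprMn -mulrDr sqrtrM ?sqr_ge0// sqrtr_sqr.
Qed.

HB.instance Definition _ :=
  PseudoMetricNormedZmod_Lmodule_isNormedModule.Build R (Rcomplex R)
    Rcomplex_normrZ.

End Rcomplex_normedModType.

Variant scalar_kind := RealScalars | ComplexScalars.

Definition scalars (R : realType) (k : scalar_kind) : normedModType R :=
  match k with
  | RealScalars => R
  | ComplexScalars => Rcomplex R
  end.

Section Nets.
Context {R : realType} {disp : Order.disp_t} {Lam : porderType disp}.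

Definition left_filtering : Prop :=
  forall l m : Lam, exists n : Lam, (n <= l)%O /\ (n <= m)%O.

Definition net_lim0 (a : Lam -> R) : Prop :=
  forall e : R, 0 < e ->
    exists l0 : Lam, forall l : Lam, (l <= l0)%O -> `|a l| <= e.

Definition net_ll (a b : Lam -> R) : Prop :=
  exists l0 : Lam, forall l : Lam, (l <= l0)%O -> a l <= b l.

Definition positive_mpoly (n : nat) (P : mpoly n R) : Prop :=
  P <> 0 /\
  forall m, mcoeff m P != 0 -> 0 < mcoeff m P.

Definition rational_nets (B0 : set (Lam -> R)) : set (Lam -> R) :=
  [set b | exists (n : nat) (x : 'I_n -> Lam -> R) (P Q : mpoly n R),
    [/\ forall i, B0 (x i), positive_mpoly P, positive_mpoly Q &
        forall l, b l = meval (x^~ l) P / meval (x^~ l) Q]].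

Context {W : normedModType R}.

Definition overgenerated_ring (B : set (Lam -> R)) : set (Lam -> W) :=
  [set a | exists2 b, B b & net_ll (fun l => `|a l|) b].

Definition canonical_ideal (B : set (Lam -> R)) : set (Lam -> W) :=
  [set a | forall b, B b -> net_ll (fun l => `|a l|) b].

Definition abs_nets (A : set (Lam -> W)) : set (Lam -> R) :=
  [set (fun l => `|r l|) | r in A].

End Nets.
Arguments left_filtering {disp} Lam.

Section Smooth.
Context {R : realType} {W : normedModType R} {d : nat}.
Implicit Types (u : 'rV[R]_d -> W) (K : set 'rV[R]_d).

Definition partial (i : 'I_d) u : 'rV[R]_d -> W :=
  fun x => 'D_(delta_mx 0 i) u x.

Definition partials (s : seq 'I_d) u : 'rV[R]_d -> W := foldr partial u s.

Definition smooth u : Prop :=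
  forall s : seq 'I_d, continuous (partials s u) /\
    forall (i : 'I_d) (x : 'rV[R]_d),
      derivable (partials s u) x (delta_mx 0 i).

Definition mpartial (alpha : 'I_d -> nat) u : 'rV[R]_d -> W :=
  foldr (fun i => iter (alpha i) (partial i)) u (enum 'I_d).

(* The library's [sup] of the empty set is 0, so the seminorms vanish when K is
   empty. *)
Definition sup_on K u : R := sup [set `|u x| | x in K].

Definition seminorm K (l : nat) u : R :=
  sup [set sup_on K (mpartial alpha u) |
       alpha in [set alpha : 'I_d -> nat | (\sum_i alpha i <= l)%N]].

End Smooth.

Section Colombeau.
Context {R : realType} {disp : Order.disp_t} {Lam : porderType disp}.
Context {W : normedModType R} {d : nat}.

Definition moderate (B : set (Lam -> R)) : set (Lam -> 'rV[R]_d -> W) :=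
  [set u | (forall l, smooth (u l)) /\
    forall (K : set 'rV[R]_d) (k : nat), compact K ->
      abs_nets (overgenerated_ring (W := W) B)
        (fun l => seminorm K k (u l))].

Definition negligible_nets (B : set (Lam -> R)) :
    set (Lam -> 'rV[R]_d -> W) :=
  [set u | (forall l, smooth (u l)) /\
    forall (K : set 'rV[R]_d) (k : nat), compact K ->
      abs_nets (canonical_ideal (W := W) B)
        (fun l => seminorm K k (u l))].

End Colombeau.

(* Main.v *)
(** Let [K'] be [K] swept by the segment [[0, 1]] in the direction [e_i].  For
    [0 < h <= 1] the first-order Taylor expansion along [e_i] gives
      [sup_K |d_i v| <= 2 sup_K' |v| / h + h sup_K' |d_i^2 v|].
    If [m] in [B] eventually bounds the last supremum and [b] in [B] is given,
    the step [h := b / (2 m + b)] lies in [B], is at most [1], and makes the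
    second term at most [b / 2]; the first one is at most [b / 2] as soon as
    [sup_K' |v| <= b h / 4], which is again a bound by an element of [B].  Hence
    negligibility passes from [v] to [d_i v], and by induction on the order from
    [u] to all its derivatives. *)

Require Import Defs.
From mathcomp Require Import all_boot all_order all_algebra.
From mathcomp Require Import all_classical all_reals all_analysis.
From mathcomp Require Import complex.
From mathcomp Require Import -(notations) mpoly.
From mathcomp Require Import ring lra.
Import Order.TTheory GRing.Theory Num.Theory.
Import numFieldNormedType.Exports.
Local Open Scope classical_set_scope.
Local Open Scope ring_scope.

(** * Polynomials with positive coefficients *)

Section PositivePolynomials.
Context {R : realType}.

Definition nonneg_mpoly {n : nat} (P : mpoly n R) := forall m, 0 <= mcoeff m P.

Lemma positive_mpoly_ge0 {n : nat} {P : mpoly n R} :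
  positive_mpoly P -> nonneg_mpoly P.
Proof. by case=> _ P0 m; case: (eqVneq (mcoeff m P) 0) => [->//|/P0/ltW]. Qed.

(** No term is negative, and the leading monomial of the nonzero [P] contributes a strictly positive
    one. *)
Lemma meval_positive_gt0 (n : nat) (P : mpoly n R) (v : 'I_n -> R) :
  positive_mpoly P -> (forall i, 0 < v i) -> 0 < meval v P.
Proof.
move=> Ppos v0; have Pge0 := positive_mpoly_ge0 Ppos.
have prod0 m : 0 < \prod_i v i ^+ (fun_of_multinom m i).
  by apply: prodr_gt0 => i _; exact: exprn_gt0.
have term0 m : 0 <= mcoeff m P * \prod_i v i ^+ (fun_of_multinom m i).
  by apply: mulr_ge0; [exact: Pge0 | exact: ltW].
rewrite mevalE lt_neqAle sumr_ge0 ?andbT// eq_sym psumr_neq0//.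
case: Ppos => /eqP Pn0 Ppos; apply/hasP; exists (mlead P).
  exact: mlead_supp.
by rewrite /= mulr_gt0// Ppos// -mcoeff_msupp mlead_supp.
Qed.

(** A nonzero value at a single point excludes the zero polynomial. Below, closure properties are
    thus checked on nonnegative coefficients, together with one evaluation at the all-ones point. *)
Lemma nonneg_positive_mpoly (n : nat) (P : mpoly n R) (v : 'I_n -> R) :
  nonneg_mpoly P -> meval v P != 0 -> positive_mpoly P.
Proof.
move=> P0 vP; split; last by move=> m mP; rewrite lt_neqAle eq_sym mP P0.
by move=> P00; rewrite P00 meval0 eqxx in vP.
Qed.

Lemma nonneg_mpolyC (n : nat) (c : R) : 0 <= c -> nonneg_mpoly (mpolyC n c).
Proof. by move=> c0 m; rewrite mcoeffC mulr_ge0. Qed.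

Lemma nonneg_mpolyX (n : nat) (m : multinom n) : nonneg_mpoly (mpolyX R m).
Proof. by move=> m'; rewrite mcoeffX. Qed.

Lemma nonneg_mpolyD (n : nat) (P Q : mpoly n R) :
  nonneg_mpoly P -> nonneg_mpoly Q -> nonneg_mpoly (P + Q).
Proof. by move=> P0 Q0 m; rewrite mcoeffD addr_ge0. Qed.

Lemma nonneg_mpolyM (n : nat) (P Q : mpoly n R) :
  nonneg_mpoly P -> nonneg_mpoly Q -> nonneg_mpoly (P * Q).
Proof.
by move=> P0 Q0 m; rewrite mcoeffM sumr_ge0// => i _; exact: mulr_ge0.
Qed.

Lemma positive_mpolyC (n : nat) (c : R) : 0 < c -> positive_mpoly (mpolyC n c).
Proof.
move=> c0; apply: (@nonneg_positive_mpoly _ _ (fun=> 1)).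
  exact/nonneg_mpolyC/ltW.
by rewrite mevalC gt_eqF.
Qed.

Lemma positive_mpolyD (n : nat) (P Q : mpoly n R) :
  positive_mpoly P -> positive_mpoly Q -> positive_mpoly (P + Q).
Proof.
move=> P0 Q0; apply: (@nonneg_positive_mpoly _ _ (fun=> 1)).
  by apply: nonneg_mpolyD; exact: positive_mpoly_ge0.
by rewrite mevalD gt_eqF// addr_gt0// meval_positive_gt0.
Qed.

Lemma positive_mpolyM (n : nat) (P Q : mpoly n R) :
  positive_mpoly P -> positive_mpoly Q -> positive_mpoly (P * Q).
Proof.
move=> P0 Q0; apply: (@nonneg_positive_mpoly _ _ (fun=> 1)).
  by apply: nonneg_mpolyM; exact: positive_mpoly_ge0.
by rewrite mevalM gt_eqF// mulr_gt0// meval_positive_gt0.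
Qed.

(** [Q] arises by substituting the variable of index [f i] for the [i]-th one. Distinct monomials
    may merge, but nonnegative coefficients cannot cancel. *)
Lemma positive_mpoly_rename (n p : nat) (f : 'I_n -> 'I_p) (P : mpoly n R) :
  positive_mpoly P -> exists2 Q : mpoly p R, positive_mpoly Q &
    forall v : 'I_p -> R, meval v Q = meval (v \o f) P.
Proof.
move=> P0; pose Q := comp_mpoly [tuple mpolyX R (mnm1 (f i)) | i < n] P.
have Qv (v : 'I_p -> R) : meval v Q = meval (v \o f) P.
  rewrite comp_mpoly_meval; apply: meval_eq => i /=.
  by rewrite tnth_mktuple mevalXU.
exists Q => //; apply: (@nonneg_positive_mpoly _ _ (fun=> 1)); last first.
  by rewrite Qv gt_eqF// meval_positive_gt0.
rewrite /Q comp_mpolyE; apply: big_ind => [|P1 P2|m _].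
- by move=> m; rewrite mcoeff0.
- exact: nonneg_mpolyD.
rewrite -mul_mpolyC; apply: nonneg_mpolyM.
  exact/nonneg_mpolyC/positive_mpoly_ge0.
apply: big_ind => [|P1 P2|i _].
- by rewrite -mpolyC1; exact: nonneg_mpolyC.
- exact: nonneg_mpolyM.
- by rewrite tnth_mktuple mpolyXn; exact: nonneg_mpolyX.
Qed.

End PositivePolynomials.

(** * Stability of the rational nets under sums, products and inverses *)

Section RationalNets.
Context {R : realType} {disp : Order.disp_t} {Lam : porderType disp}.
Context {B0 : set (Lam -> R)} (B0_pos : forall b, B0 b -> forall l, 0 < b l).
Local Notation B := (rational_nets B0).

Lemma rational_nets_gt0 (b : Lam -> R) : B b -> forall l, 0 < b l.
Proof.
move=> [n [x [P [Q [xB P0 Q0 bE]]]]] l; rewrite bE.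
by rewrite divr_gt0// meval_positive_gt0// => i; exact: B0_pos.
Qed.

(** Concatenating the two families of variables puts both quotients over the same variables, so that
    sums and products become fraction arithmetic. *)
Lemma rational_nets_common (b c : Lam -> R) : B b -> B c ->
  exists (n : nat) (x : 'I_n -> Lam -> R) (P Q S T : mpoly n R),
    [/\ forall i, B0 (x i), positive_mpoly P /\ positive_mpoly Q,
        positive_mpoly S /\ positive_mpoly T,
        forall l, b l = meval (x^~ l) P / meval (x^~ l) Q &
        forall l, c l = meval (x^~ l) S / meval (x^~ l) T].
Proof.
move=> [n [x [P [Q [xB P0 Q0 bE]]]]] [p [y [S [T [yB S0 T0 cE]]]]].
have [P' P'0 P'E] := positive_mpoly_rename _ _ (lshift p) _ P0.
have [Q' Q'0 Q'E] := positive_mpoly_rename _ _ (lshift p) _ Q0.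
have [S' S'0 S'E] := positive_mpoly_rename _ _ (@rshift n p) _ S0.
have [T' T'0 T'E] := positive_mpoly_rename _ _ (@rshift n p) _ T0.
exists (n + p)%N.
exists (fun i => match fintype.split i with inl j => x j | inr j => y j end).
exists P', Q', S', T'; split => // [i|l|l].
- by case: fintype.split.
- rewrite P'E Q'E bE; congr (_ / _); apply: meval_eq => i /=;
  by rewrite (unsplitK (inl _ i)).
- rewrite S'E T'E cE; congr (_ / _); apply: meval_eq => i /=;
  by rewrite (unsplitK (inr _ i)).
Qed.

Lemma rational_nets_cst (c : R) : 0 < c -> B (fun=> c).
Proof.
move=> c0; exists 0%N, (fun=> fun=> c), (mpolyC 0 c), (mpolyC 0 1).
split; [by case|exact: positive_mpolyC|exact: positive_mpolyC|].
by move=> l; rewrite !mevalC divr1.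
Qed.

Lemma rational_netsD (b c : Lam -> R) : B b -> B c -> B (fun l => b l + c l).
Proof.
move=> Bb Bc.
have [n [x [P [Q [S [T [xB [P0 Q0] [S0 T0] bE cE]]]]]]] :=
  rational_nets_common _ _ Bb Bc.
exists n, x, (P * T + S * Q), (Q * T); split => //.
- by apply: positive_mpolyD; apply: positive_mpolyM.
- exact: positive_mpolyM.
- move=> l; rewrite bE cE mevalD !mevalM addf_div//.
  all: by rewrite gt_eqF// meval_positive_gt0// => i; exact: B0_pos.
Qed.

Lemma rational_netsM (b c : Lam -> R) : B b -> B c -> B (fun l => b l * c l).
Proof.
move=> Bb Bc.
have [n [x [P [Q [S [T [xB [P0 Q0] [S0 T0] bE cE]]]]]]] :=
  rational_nets_common _ _ Bb Bc.
exists n, x, (P * S), (Q * T); split => //.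
- exact: positive_mpolyM.
- exact: positive_mpolyM.
- by move=> l; rewrite bE cE !mevalM mulf_div.
Qed.

Lemma rational_netsV (b : Lam -> R) : B b -> B (fun l => (b l)^-1).
Proof.
move=> [n [x [P [Q [xB P0 Q0 bE]]]]]; exists n, x, Q, P; split => // l.
by rewrite bE invf_div.
Qed.

End RationalNets.

(** * Mean value inequality and derivative interpolation on the line *)

Section MeanValue.
Context {R : realType} {W : normedModType R}.
Implicit Types f : R -> W.

(* Past the last point [c] of [[a, b]] where [`|f t - f a| <= (M + e) * (t - a)]
   the derivative bound at [c] would propagate this inequality further. *)
Lemma mean_value_le f (a b M : R) : a <= b ->
  (forall t, derivable f t 1) ->
  (forall t, a <= t <= b -> `|'D_1 f t| <= M) ->
  `|f b - f a| <= M * (b - a).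
Proof.
move=> ab df fM; apply/ler_addgt0Pl => e' e'0.
(* The [+ 1] keeps the denominator positive when [a = b], and still [e * (b - a) <= e']. *)
pose e := e' / (b - a + 1); have ba1 : 0 < b - a + 1 by lra.
have e0 : 0 < e by rewrite divr_gt0.
suff : `|f b - f a| <= (M + e) * (b - a).
  move/le_trans; apply; rewrite mulrDl addrC lerD2r /e -mulrA.
  rewrite ler_piMr ?(ltW e'0)//.
  by rewrite ler_pdivrMl// mulr1; lra.
pose psi t : R := `|f t - f a| - (M + e) * (t - a).
have cf : continuous f.
  by move=> t; apply: differentiable_continuous; exact/derivable1_diffP.
have cpsi : continuous psi.
  move=> t; apply: cvgB.
    by apply: cvg_norm; apply: cvgB; [exact: cf|exact: cvg_cst].
  by apply: cvgMl_tmp; apply: cvgB; [exact: cvg_id|exact: cvg_cst].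
pose A := [set` `[a, b]] `&` psi @^-1` [set x | x <= 0].
have cA : compact A.
  apply: compact_closedI; first exact: segment_compact.
  by apply: closed_comp => [t _|]; [exact: cpsi|exact: closed_le].
have A0 : A !=set0.
  exists a; split => /=; first by rewrite in_itv/= lexx ab.
  by rewrite /psi !subrr normr0 mulr0 subrr.
have [|c /set_mem[/= cab psic] cmax] := compact_EVT_max A0 cA (f := id).
  by apply: continuous_subspaceT => t; exact: cvg_id.
move: cab; rewrite in_itv/= => /andP[ac cb].
have [cb'|cltb] := leP b c.
  have <- : c = b by apply/le_anti; rewrite cb.
  by rewrite -subr_le0.
have lt_e : `|'D_1 f c| < M + e.
  by rewrite (le_lt_trans (fM _ _)) ?ac ?cb// ltrDl.
have := cvgr_norm_lt _ (df c : _ --> 'D_1 f c) _ lt_e.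
rewrite /dnbhs near_withinE => /(_ _)/nbhs_ballP[r /= r0 Hr].
(* This step stays strictly inside the ball where difference quotients at [c] are below [M + e], and
   does not pass [b]. Hence [h + c] lies in [A], against the maximality of [c]. *)
pose h := Num.min (r / 2) (b - c).
have h0 : 0 < h by rewrite /h lt_min; apply/andP; split; lra.
have hr : h < r by rewrite /h gt_min; apply/orP; left; lra.
have hb : h <= b - c by rewrite /h ge_min lexx orbT.
have := Hr h; rewrite /ball/= sub0r normrN (gtr0_norm h0) => /(_ hr).
rewrite (gt_eqF h0) => /(_ isT).
rewrite normrZ normfV (gtr0_norm h0) [_%:A]mulr1 ltr_pdivrMl// => dh.
have : A (h + c).
  split; rewrite /= ?in_itv/=; first by apply/andP; split; lra.
  have := ler_distD (f c) (f (h + c)) (f a); move: psic; rewrite /psi /=.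
  have -> : (M + e) * (h + c - a) = h * (M + e) + (M + e) * (c - a) by ring.
  by move: dh; rewrite /shift/=; lra.
by move=> /mem_set/cmax/=; lra.
Qed.

(** Two mean value inequalities replace Taylor's formula for vector values: the first, for ['D_1 f],
    bounds the derivative of [g t = f t - t *: w] by [h * M]; the second bounds [g h - g 0] by
    [h * M * h]. What remains of [h *: w] is [f h - f 0]. *)
Lemma derivative_interpolation f (h S M : R) : 0 < h ->
  (forall t, derivable f t 1) -> (forall t, derivable ('D_1 f) t 1) ->
  (forall t, 0 <= t <= h -> `|f t| <= S) ->
  (forall t, 0 <= t <= h -> `|'D_1 ('D_1 f) t| <= M) ->
  `|'D_1 f 0| <= 2 * S / h + h * M.
Proof.
move=> h0 df ddf fS fM.
have M0 : 0 <= M.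
  by apply: le_trans (fM 0 _); rewrite ?lexx ?(ltW h0)// normr_ge0.
pose w := 'D_1 f 0; pose g t := f t - t *: w.
have gE t : is_derive t (1 : R) g ('D_1 f t - w).
  apply: is_deriveB; first exact: derivableP.
  have dw : differentiable (fun s : R => s *: w) t.
    by apply: differentiableZl; exact/derivable1_diffP/derivable_id.
  apply: DeriveDef; first exact: diff_derivable.
  by rewrite deriveE// diffZl ?diff_val ?scale1r.
have gM : `|g h - g 0| <= (h * M) * (h - 0).
  apply: (mean_value_le g); first exact: ltW.
    by move=> t; exact: ex_derive.
  move=> t /andP[t0 th]; rewrite derive_val.
  apply: (@le_trans _ _ (M * (t - 0))); last first.
    by rewrite subr0 mulrC ler_wpM2r.
  apply: (mean_value_le ('D_1 f) 0 t M) => // s /andP[s0 st]; apply: fM.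
  by rewrite s0 (le_trans st).
have hw : h *: w = (f h - f 0) - (g h - g 0).
  by rewrite /g scale0r subr0 opprB addrA subrK opprB addrCA subrr addr0.
have : h * `|w| <= 2 * S + h * M * h.
  rewrite -{1}(gtr0_norm h0) -normrZ hw (le_trans (ler_normB _ _))// lerD//.
    rewrite (le_trans (ler_normB _ _))// mulr2n mulrDl mul1r lerD//; apply: fS.
      by rewrite (ltW h0) lexx.
    by rewrite lexx (ltW h0).
  by rewrite subr0 in gM.
move=> ?; rewrite -(ler_pM2l h0) mulrDr [h * (_ / h)]mulrC divfK ?gt_eqF//.
by rewrite [h * (h * M)]mulrC.
Qed.

End MeanValue.

(** * Suprema over compact sets and restriction to lines *)

Section SupNorm.
Context {R : realType} {W : normedModType R} {d : nat}.
Implicit Types (u v : 'rV[R]_d -> W) (K : set 'rV[R]_d).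

Lemma sup_on_ge0 K u : 0 <= sup_on K u.
Proof.
rewrite /sup_on.
have [hs|/sup_out ->] := pselect (has_sup [set `|u x| | x in K]); last by [].
have [[y [x Kx xy]] ub] := hs.
by apply: le_trans (ub_le_sup ub _); [exact: (normr_ge0 (u x))|exists x].
Qed.

(** The bound [0 <= c] serves the empty [K], whose supremum is 0 by default. *)
Lemma sup_on_le K u c : 0 <= c -> (forall x, K x -> `|u x| <= c) ->
  sup_on K u <= c.
Proof.
move=> c0 uc; rewrite /sup_on; have [->|/set0P[x Kx]] := eqVneq K set0.
  by rewrite image_set0 sup0.
by apply: ge_sup => [|_ [y Ky <-]]; [exists `|u x|, x|exact: uc].
Qed.

Lemma norm_le_sup_on K u x : compact K -> continuous u -> K x ->
  `|u x| <= sup_on K u.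
Proof.
move=> cK cu Kx; apply: ub_le_sup; last by exists x.
have cnu : {within K, continuous (fun y => `|u y|)}.
  apply: continuous_subspaceT => y.
  exact: (@continuous_comp _ _ _ u Num.norm y (cu y) (@norm_continuous _ _ (u y))).
have [|c _ cmax] := compact_EVT_max _ cK cnu; first by exists x.
by exists `|u c| => _ [y Ky <-]; apply: cmax; exact: mem_set.
Qed.

Definition sweep (e : 'rV[R]_d) K : set 'rV[R]_d :=
  [set p.1 + p.2 *: e | p in K `*` [set` `[0 : R, 1]]].

Lemma compact_sweep e K : compact K -> compact (sweep e K).
Proof.
move=> cK; apply: continuous_compact; last first.
  by apply: compact_setX => //; exact: segment_compact.
apply: continuous_subspaceT => p; apply: cvgD; first exact: cvg_fst.
by apply: cvgZr_tmp; exact: cvg_snd.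
Qed.

(** Equality of the difference quotients as functions transfers both derivability and the derivative
    between a line and the direction [e]. *)
Lemma quotient_line u (x e : 'rV[R]_d) (t : R) :
  (fun h : R => h^-1 *:
     (((fun s : R => u (x + s *: e)) \o shift t) (h *: 1) - u (x + t *: e))) =
  (fun h : R => h^-1 *: ((u \o shift (x + t *: e)) (h *: e) - u (x + t *: e))).
Proof.
by apply/funext => h /=; rewrite [_%:A]mulr1 scalerDl [x + (_ + _)]addrCA.
Qed.

Lemma derive_line u (x e : 'rV[R]_d) (t : R) :
  'D_1 (fun s : R => u (x + s *: e)) t = 'D_e u (x + t *: e).
Proof. by rewrite /derive quotient_line. Qed.

Lemma derivable_line u (x e : 'rV[R]_d) (t : R) :
  derivable u (x + t *: e) e -> derivable (fun s : R => u (x + s *: e)) t 1.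
Proof. by rewrite /derivable quotient_line. Qed.

(** The one-variable inequality is applied to [v] on the segment from each [x] in [K]; [h <= 1]
    keeps this segment inside the swept set. *)
Lemma sup_partial_interpolation K (i : 'I_d) v (h : R) :
  compact K -> 0 < h -> h <= 1 ->
  continuous v -> continuous (partial i (partial i v)) ->
  (forall x, derivable v x (delta_mx 0 i)) ->
  (forall x, derivable (partial i v) x (delta_mx 0 i)) ->
  sup_on K (partial i v) <=
    2 * sup_on (sweep (delta_mx 0 i) K) v / h +
    h * sup_on (sweep (delta_mx 0 i) K) (partial i (partial i v)).
Proof.
move=> cK h0 h1 cv cv2 dv dv2; set e := delta_mx 0 i; set K' := sweep e K.
have cK' : compact K' by exact: compact_sweep.
apply: sup_on_le => [|x Kx].
  by rewrite addr_ge0 ?divr_ge0 ?mulr_ge0 ?sup_on_ge0// ltW.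
have K't t : 0 <= t <= h -> K' (x + t *: e).
  move=> /andP[t0 th]; exists (x, t) => //; split => //=.
  by rewrite in_itv/= t0 (le_trans th).
pose f (t : R) := v (x + t *: e).
have df : 'D_1 f = fun t => partial i v (x + t *: e).
  by apply/funext => t; rewrite derive_line.
have -> : partial i v x = 'D_1 f 0 by rewrite derive_line scale0r addr0.
apply: derivative_interpolation => // [t|t|t th|t th].
- exact: derivable_line.
- by rewrite df; exact: derivable_line.
- exact/norm_le_sup_on/K't.
- rewrite df (derive_line (partial i v)).
  by apply: (norm_le_sup_on K' (partial i (partial i v))) => //; exact: K't.
Qed.

End SupNorm.

(** * Multi-indices and seminorms *)

Section MultiIndices.
Context {R : realType} {W : normedModType R} {d : nat}.
Implicit Types (u : 'rV[R]_d -> W) (alpha : 'I_d -> nat).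

(** This links multi-index derivatives to the lists of directions in terms of which [smooth] is
    stated. *)
Lemma mpartial_partials alpha :
  exists s : seq 'I_d, forall u, mpartial alpha u = partials s u.
Proof.
exists (flatten [seq nseq (alpha i) i | i <- enum 'I_d]) => u.
rewrite /mpartial /partials; elim: (enum _) => //= i s ->.
by rewrite foldr_cat; elim: (alpha i) => //= n ->.
Qed.

Lemma mpartial0 alpha u : (forall i, alpha i = 0%N) -> mpartial alpha u = u.
Proof.
by move=> a0; rewrite /mpartial; elim: (enum _) => //= i s ->; rewrite a0.
Qed.

(* [mpartial] differentiates along the smallest index last, so that only a new
   smallest index can be peeled off without exchanging derivatives. *)
Lemma mpartial_succ alpha beta (i : 'I_d) u :
  (forall j : 'I_d, (j < i)%N -> alpha j = 0%N) ->
  (forall j, beta j = (alpha j + (j == i))%N) ->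
  mpartial beta u = partial i (mpartial alpha u).
Proof.
move=> a0 bE; rewrite /mpartial.
have : i \in enum 'I_d by rewrite mem_enum.
have : sorted ltn (map val (enum 'I_d)) by rewrite val_enum_ord iota_ltn_sorted.
(* The enumeration is increasing, so [s1] holds the indices below [i], where both exponents vanish,
   and [s2] those above, where they agree. *)
move=> /[swap] /splitPr[s1 s2].
rewrite map_cat /= (sorted_pairwise ltn_trans) pairwise_cat /=.
move=> /and3P[s1i _ /andP[s2i _]]; rewrite !foldr_cat /=.
have bi : beta i = (alpha i).+1 by rewrite bE eqxx addn1.
have -> : foldr (fun j => iter (beta j) (partial j)) u s2 =
          foldr (fun j => iter (alpha j) (partial j)) u s2.
  elim: s2 s2i {s1i} => //= j s2 IH /andP[ij s2i]; rewrite IH// bE.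
  by case: eqVneq ij => [->|_ _]; rewrite ?ltnn ?addn0.
rewrite bi /=; set w := partial i _.
have low j : j \in s1 -> (j < i)%N.
  by move=> js1; exact: (allrelP s1i _ _ (map_f val js1) (mem_head _ _)).
have idl (g : 'I_d -> nat) v : (forall j, j \in s1 -> g j = 0%N) ->
    foldr (fun j => iter (g j) (partial j)) v s1 = v.
  elim: s1 {low s1i} => //= j s1 IH g0; rewrite g0 ?mem_head// IH// => k ks.
  by rewrite g0// inE ks orbT.
rewrite !idl// => j /low ji; first exact: a0.
by rewrite bE a0//; case: eqVneq ji => [->|]; rewrite ?ltnn.
Qed.

(** Lowering the exponent at the smallest index of the support gives a [beta] that vanishes below
    [i], as [mpartial_succ] requires. *)
Lemma multi_index_pred alpha n : (\sum_i alpha i = n.+1)%N ->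
  exists (beta : 'I_d -> nat) (i : 'I_d),
    [/\ (\sum_i beta i = n)%N, forall j : 'I_d, (j < i)%N -> beta j = 0%N &
        forall j, alpha j = (beta j + (j == i))%N].
Proof.
move=> an.
have [i0 ai0] : exists i, (0 < alpha i)%N.
  apply/not_existsP => a0; suff : (\sum_i alpha i = 0)%N by rewrite an.
  by apply: big1 => i _; apply/eqP; rewrite -leqn0 leqNgt; exact/negP/a0.
case: (@arg_minnP _ i0 (fun i => (0 < alpha i)%N) (fun i => i : nat) ai0).
move=> i ai imin.
exists (fun j => alpha j - (j == i))%N, i.
(* The truncated subtraction loses nothing because [0 < alpha i]. *)
have aE j : alpha j = (alpha j - (j == i) + (j == i))%N.
  by rewrite subnK//; case: eqVneq => [->|].
split => // [|j ji].
  have i1 : (\sum_(j < d) (j == i) = 1)%N.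
    by rewrite (bigD1 i)//= eqxx big1// => j /negbTE ->.
  apply/eqP; rewrite -(eqn_add2r 1) -{1}i1 -big_split addn1 -an; apply/eqP.
  by apply: eq_bigr => j _ /=; rewrite -aE.
apply/eqP; rewrite subn_eq0 leqNgt; apply/negP => /(leq_ltn_trans (leq0n _)).
by move=> /imin; rewrite leqNgt ji.
Qed.

Lemma seminorm_le K (k : nat) u c :
  (forall alpha, (\sum_i alpha i <= k)%N -> sup_on K (mpartial alpha u) <= c) ->
  seminorm K k u <= c.
Proof.
move=> uc; apply: ge_sup => [|_ [alpha ak <-]]; last exact: uc.
by exists (sup_on K (mpartial (fun=> 0%N) u)), (fun=> 0%N) => //=; rewrite big1.
Qed.

(** Each entry is at most the order, so the multi-indices of order at most [k] lie in a finite
    type. *)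
Lemma multi_index_bounded alpha (k : nat) : (\sum_i alpha i <= k)%N ->
  exists t : {ffun 'I_d -> 'I_k.+1}, alpha = fun i => t i.
Proof.
move=> ak; exists [ffun i => inord (alpha i)]; apply/funext => i.
rewrite ffunE inordK// ltnS (leq_trans _ ak)//.
by rewrite (bigD1 i)//= leq_addr.
Qed.

Lemma sup_on_le_seminorm K (k : nat) u alpha : (\sum_i alpha i <= k)%N ->
  sup_on K (mpartial alpha u) <= seminorm K k u.
Proof.
move=> ak; apply: ub_le_sup; last by exists alpha.
(* A crude upper bound: the sum of finitely many nonnegative suprema dominates each of them. *)
exists (\sum_(t : {ffun 'I_d -> 'I_k.+1}) sup_on K (mpartial (fun i => t i) u)).
move=> _ [beta /multi_index_bounded[t ->] <-].
by rewrite (bigD1 t)//= lerDl sumr_ge0// => t' _; exact: sup_on_ge0.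
Qed.

Lemma seminorm_ge0 K (k : nat) u : 0 <= seminorm K k u.
Proof.
apply: le_trans (sup_on_ge0 K (mpartial (fun=> 0%N) u)) _.
by apply: sup_on_le_seminorm; rewrite big1.
Qed.

End MultiIndices.

(** Scaling a unit vector by a nonnegative real net gives a scalar net with that net as its modulus;
    membership in [abs_nets] then reduces to real inequalities. *)
Lemma scalars_unit_vector (R : realType) (k : scalar_kind) :
  exists e : scalars R k, `|e| = 1.
Proof.
case: k => /=; first by exists 1; rewrite normr1.
exists (Complex 1 0 : Rcomplex R).
rewrite /Num.norm/= /ComplexField.Normc.normc/=.
by rewrite expr1n expr0n/= addr0 sqrtr1.
Qed.

(** * Eventual inequalities along the filtering index set *)

Section Nets.
Context {R : realType} {disp : Order.disp_t} {Lam : porderType disp}.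
Context (Lam_nonempty : inhabited Lam) (Lam_filtering : left_filtering Lam).

Lemma net_ll_and (a b c e : Lam -> R) : net_ll a b -> net_ll c e ->
  exists l0, forall l, (l <= l0)%O -> a l <= b l /\ c l <= e l.
Proof.
move=> [l1 H1] [l2 H2]; have [l0 [l01 l02]] := Lam_filtering l1 l2.
exists l0 => l ll0; split; first exact/H1/(le_trans ll0).
exact/H2/(le_trans ll0).
Qed.

Lemma net_ll_fin (T : finType) (a : T -> Lam -> R) (b : Lam -> R) :
  (forall t, net_ll (a t) b) ->
  exists l0, forall l, (l <= l0)%O -> forall t, a t l <= b l.
Proof.
move=> ab.
suff [l0 H0] : exists l0, forall l, (l <= l0)%O ->
    forall t, t \in enum T -> a t l <= b l.
  by exists l0 => l /H0 H t; apply: H; rewrite mem_enum.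
elim: (enum T) => [|t s [l1 H1]]; first by have [l0] := Lam_nonempty; exists l0.
have [l2 H2] := ab t; have [l0 [l01 l02]] := Lam_filtering l1 l2.
exists l0 => l ll0 t'; rewrite inE => /predU1P[->|ts].
  exact/H2/(le_trans ll0).
by apply: H1 => //; exact: le_trans l01.
Qed.

Lemma abs_canonical_ideal (W : normedModType R) (e : W) (B : set (Lam -> R))
    (f : Lam -> R) : `|e| = 1 -> (forall l, 0 <= f l) ->
  abs_nets (canonical_ideal (W := W) B) f <-> forall b, B b -> net_ll f b.
Proof.
move=> e1 f0; split => [[r rI <-] b /rI//|fB].
have fE l : `|f l *: e| = f l by rewrite normrZ e1 mulr1 ger0_norm.
exists (fun l => f l *: e); last exact/funext.
by move=> b /fB; rewrite (_ : (fun l => `|f l *: e|) = f)//; exact/funext.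
Qed.

End Nets.

(** * Passage from order zero to all derivatives *)

Section Negligible.
Context {R : realType} {disp : Order.disp_t} {Lam : porderType disp}.
Context (Lam_filtering : left_filtering Lam).
Context {B0 : set (Lam -> R)} (B0_pos : forall b, B0 b -> forall l, 0 < b l).
Context {W : normedModType R} {d : nat}.
Local Notation B := (rational_nets B0).

(** In the induction on the order, [K] and [b] stay quantified: the step uses the hypothesis on the
    swept set and with another element of [B]. *)
Lemma sup_mpartial_negligible (u : Lam -> 'rV[R]_d -> W) : moderate B u ->
  (forall K, compact K -> forall b, B b -> net_ll (fun l => sup_on K (u l)) b) ->
  forall alpha K, compact K ->
    forall b, B b -> net_ll (fun l => sup_on K (mpartial alpha (u l))) b.
Proof.
move=> [us umod] u0 alpha.
move: {2}(\sum_i alpha i)%N (erefl (\sum_i alpha i)%N) => n.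
elim: n alpha => [|n IH] alpha an K cK b Bb.
  have a0 i : alpha i = 0%N.
    by apply/eqP; move: an => /eqP; rewrite sum_nat_eq0 => /forallP/(_ i).
  by have [l0 H0] := u0 K cK b Bb; exists l0 => l /H0; rewrite mpartial0.
have [beta [i [bn bi aE]]] := multi_index_pred _ _ an.
have alphaE v : mpartial alpha v = partial i (mpartial beta v).
  exact: mpartial_succ.
(* As [alpha] is [beta] plus one derivative along [i], [gamma] is [beta] plus two; [alpha] also
   vanishes below [i], so [mpartial_succ] applies again. *)
pose gamma j := (alpha j + (j == i))%N.
have gammaE v : mpartial gamma v = partial i (partial i (mpartial beta v)).
  rewrite -alphaE; apply: mpartial_succ => // j ji.
  by rewrite aE bi//; case: eqVneq ji => [->|]; rewrite ?ltnn.
pose K' := sweep (delta_mx 0 i) K.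
have cK' : compact K' by exact: compact_sweep.
pose k := (\sum_i gamma i)%N.
have [r [m Bm rm] rE] := umod K' k cK'.
have {rm}mB : net_ll (fun l => sup_on K' (mpartial gamma (u l))) m.
  have [l0 H0] := rm; exists l0 => l /H0; apply: le_trans.
  by rewrite -[`|r l|]/((fun l => `|r l|) l) rE; exact: sup_on_le_seminorm.
pose h l := b l * (2 * m l + b l)^-1.
have Bh : B h.
  apply: rational_netsM => //; apply: rational_netsV; apply: rational_netsD => //.
  by apply: rational_netsM => //; apply: rational_nets_cst.
have Bs : B (fun l => 4^-1 * (b l * h l)).
  apply: rational_netsM; first by apply: rational_nets_cst; lra.
  exact: rational_netsM.
have [l0 H0] := net_ll_and Lam_filtering _ _ _ _ mB (IH beta bn K' cK' _ Bs).
exists l0 => l /H0[{H0}]; rewrite gammaE alphaE.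
have b0 := rational_nets_gt0 B0_pos _ Bb l.
have m0 := rational_nets_gt0 B0_pos _ Bm l.
have h0 := rational_nets_gt0 B0_pos _ Bh l.
have hE : h l * (2 * m l + b l) = b l by rewrite /h divfK// gt_eqF//; lra.
have h1 : h l <= 1 by rewrite ler_pdivrMr; lra.
(* Along the list [s], smoothness at [s], [i :: s] and [i :: i :: s] supplies all regularity that
   the interpolation asks for. *)
have [s sE] := @mpartial_partials R W d beta; rewrite sE => mK' bK'.
have [cv dv] := us l s; have [_ dv1] := us l (i :: s).
have [cv2 _] := us l (i :: i :: s).
have interp :=
  sup_partial_interpolation K i _ _ cK h0 h1 cv cv2 (dv i) (dv1 i).
apply: le_trans interp _.
have : 2 * sup_on K' (partials s (u l)) / h l <= b l / 2.
  by rewrite ler_pdivrMr//; lra.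
have : h l * sup_on K' (partial i (partial i (partials s (u l)))) <= h l * m l.
  by rewrite ler_pM2l.
(* By [hE], [2 * h l * m l = b l - h l * b l <= b l], so the second term is at most [b l / 2]. *)
rewrite -/K'; nra.
Qed.

End Negligible.

(** * Negligibility of moderate nets from estimates of order zero *)

Theorem proposition3 (R : realType) (k : scalar_kind)
    (disp : Order.disp_t) (Lam : porderType disp)
    (Lam_nonempty : inhabited Lam) (Lam_filtering : left_filtering Lam)
    (B0 : set (Lam -> R)) (B0_pos : forall b, B0 b -> forall l, 0 < b l)
    (d : nat) (d_ge1 : (1 <= d)%N)
    (exists_null : exists2 a, rational_nets B0 a & net_lim0 a)
    (u : Lam -> 'rV[R]_d -> scalars R k)
    (u_moderate : moderate (rational_nets B0) u) :
  negligible_nets (rational_nets B0) u <->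
  (forall K : set 'rV[R]_d, compact K ->
     abs_nets (canonical_ideal (W := scalars R k) (rational_nets B0))
       (fun l => sup_on K (u l))).
Proof.
have [e e1] := scalars_unit_vector R k.
have supP K := abs_canonical_ideal _ e (rational_nets B0) _ e1
  (fun l => sup_on_ge0 K (u l)).
have semiP K n := abs_canonical_ideal _ e (rational_nets B0) _ e1
  (fun l => seminorm_ge0 K n (u l)).
split=> [[_ uN] K cK|uK].
  apply/supP => b Bb.
  have [l0 H0] := (semiP K 0%N).1 (uN K 0%N cK) b Bb.
  exists l0 => l /H0; apply: le_trans.
  rewrite -[X in sup_on K X](mpartial0 (fun=> 0%N))//.
  by apply: sup_on_le_seminorm; rewrite big1.
split=> [|K n cK]; first by case: u_moderate.
apply/semiP => b Bb.
have uK0 : forall K, compact K -> forall b, rational_nets B0 b ->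
    net_ll (fun l => sup_on K (u l)) b by move=> K' cK'; apply/supP/uK.
(* One [l0] serves all finite functions [t]; these include every multi-index of order at most
   [n]. *)
have [|l0 H0] := net_ll_fin Lam_nonempty Lam_filtering {ffun 'I_d -> 'I_n.+1}
  (fun t l => sup_on K (mpartial (fun i => t i) (u l))) b.
  by move=> t; apply: (sup_mpartial_negligible Lam_filtering B0_pos _ u_moderate uK0).
exists l0 => l /H0 {}H0; apply: seminorm_le => alpha.
by move=> /multi_index_bounded[t ->]; exact: H0.
Qed.
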